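(* Let $n\ge 1$, let $A,B$ be real symmetric $n\times n$ matrices, $a,b\in\mathbb{R}^n$, $f(x)=\langle Ax,x\rangle+\langle a,x\rangle$, $g(x)=\langle Bx,x\rangle+\langle b,x\rangle$, $F(x)=(f(x),g(x))$, $F_H(x)=(\langle Ax,x\rangle,\langle Bx,x\rangle)$ and $F_L(x)=(\langle a,x\rangle,\langle b,x\rangle)$ for $x\in\mathbb{R}^n$. Let $d=(d_1,d_2)\in\mathbb{R}^2$, $d\ne 0$. The following assertions are equivalent: (a) $F(\mathbb{R}^n)+\mathbb{R}_+d$ is nonconvex; (b) all of the following hold: (b1) $F_L(\ker A\cap\ker B)=\{0\}$; (b2) $d_2A=d_1B$; (b3) $F_H^{-1}(-d)\ne\emptyset$ and $\{d,F_L(u)\}$ is linearly independent for all $u\in F_H^{-1}(-d)$.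
   Context: $\mathbb{R}_+=[0,+\infty[$ and $\mathbb{R}_+d=\{td: t\ge 0\}$. $F_H^{-1}(-d)=\{u\in\mathbb{R}^n: F_H(u)=-d\}$. *)

(* Defs.v *)
From mathcomp Require Import all_boot all_order all_algebra.
From mathcomp Require Import all_classical all_reals convex.

Set Implicit Arguments.
Unset Strict Implicit.
Unset Printing Implicit Defensive.

Import Order.TTheory GRing.Theory Num.Theory.

Local Open Scope classical_set_scope.
Local Open Scope ring_scope.

(* R^2 as a vector space over R: the regular copies R^o provide the scaling
   and the finite-dimensional structure that a bare R * R would lack. *)
Notation plane R := (R^o * R^o)%type.

Definition dotmx (R : realType) (n : nat) (x y : 'cV[R]_n) : R :=
  (x^T *m y) 0 0.

Definition quadf (R : realType) (n : nat) (A : 'M[R]_n) (a x : 'cV[R]_n) : R :=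
  dotmx (A *m x) x + dotmx a x.

Definition Fmap (R : realType) (n : nat) (A B : 'M[R]_n) (a b x : 'cV[R]_n) :
  plane R := (quadf A a x, quadf B b x).

Definition FH (R : realType) (n : nat) (A B : 'M[R]_n) (x : 'cV[R]_n) :
  plane R := (dotmx (A *m x) x, dotmx (B *m x) x).

Definition FL (R : realType) (n : nat) (a b x : 'cV[R]_n) :
  plane R := (dotmx a x, dotmx b x).

(* mathcomp's kermx is the left kernel; this is the kernel of x |-> A x. *)
Definition kerset (R : realType) (n : nat) (A : 'M[R]_n) : set 'cV[R]_n :=
  [set x | A *m x = 0].

Definition ray (R : realType) (d : plane R) : set (plane R) :=
  [set t *: d | t in `[0, +oo[].

Definition minkowski_sum (V : zmodType) (X Y : set V) : set V :=
  [set x + y | x in X & y in Y].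

(* Main.v *)
(* In the coordinates h = d_1 g - d_2 f, k = d_1 f + d_2 g of the plane, the set
   F(R^n) + R_+ d is E = {(t, s) | exists x, h(x) = t and k(x) <= s}.  Let H, K
   be the matrices and e, c the linear parts of h, k; (b2) says H = 0.

   Convexity of E is tested on a segment [x, y].  On the line through x and y,
   h takes the required value t at one point inside the segment and, if it is
   really quadratic there, at one outside; after subtracting a multiple of h
   from k, one of the two works.  The remaining case is <Hv, v> = 0 > <Kv, v>
   with v = y - x and h(x) <> h(y).  If H <> 0, the point at infinity in the
   direction v is then a limit of points of any level set of h, along which k
   tends to -oo, so E is the whole plane.  If H = 0, E is convex as soon as k
   can be pushed down inside a level set of the linear form e, which happens
   exactly when (b1) or the second half of (b3) fails.

   Conversely, under (b), (b1) puts c in the range of K, so k has a critical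
   point x0.  As K >= 0 on the kernel of e, k >= k(x0) on the level set of h
   through x0, whereas k(x0 + u) = k(x0 - u) < k(x0) when F_H(u) = -d, so E does
   not contain the midpoint of the images of x0 + u and x0 - u. *)

Require Import Defs.
From mathcomp Require Import all_boot all_order all_algebra.
From mathcomp Require Import all_classical all_reals convex.
From mathcomp Require Import ring lra.

Import Order.TTheory GRing.Theory Num.Theory.

Local Open Scope classical_set_scope.
Local Open Scope ring_scope.

(* [spectral.dotmx] shadows the definition of [Defs]. *)
Local Notation dotmx := Defs.dotmx.

(** * Bilinear and quadratic forms given by matrices *)

Section Dot.
Context {R : realType} {n : nat}.
Implicit Types (M N : 'M[R]_n) (x y v w m : 'cV[R]_n) (c t : R).

Lemma dotmxDl x y v : dotmx (x + y) v = dotmx x v + dotmx y v.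
Proof. by rewrite /dotmx raddfD mulmxDl mxE. Qed.

Lemma dotmxZl c x v : dotmx (c *: x) v = c * dotmx x v.
Proof. by rewrite /dotmx linearZ -scalemxAl mxE. Qed.

Lemma dotmxDr x y v : dotmx v (x + y) = dotmx v x + dotmx v y.
Proof. by rewrite /dotmx mulmxDr mxE. Qed.

Lemma dotmxZr c x v : dotmx v (c *: x) = c * dotmx v x.
Proof. by rewrite /dotmx -scalemxAr mxE. Qed.

Lemma dotmxC x y : dotmx x y = dotmx y x.
Proof. by rewrite /dotmx -[in LHS](trmxK y) -trmx_mul mxE. Qed.

Lemma dotmxBl x y v : dotmx (x - y) v = dotmx x v - dotmx y v.
Proof. by rewrite -scaleN1r dotmxDl dotmxZl mulN1r. Qed.

Lemma dotmx0l v : dotmx 0 v = 0.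
Proof. by rewrite /dotmx trmx0 mul0mx mxE. Qed.

Lemma dotmx_mull M x y : M^T = M -> dotmx (M *m x) y = dotmx x (M *m y).
Proof. by move=> sM; rewrite /dotmx trmx_mul sM mulmxA. Qed.

Lemma dotmx_mulC M x y : M^T = M -> dotmx (M *m x) y = dotmx (M *m y) x.
Proof. by move=> sM; rewrite dotmx_mull // dotmxC. Qed.

Lemma dotmx_self_neq0 x : x != 0 -> dotmx x x != 0.
Proof.
apply: contraNneq; rewrite /dotmx mxE => /eqP.
rewrite psumr_eq0 => [/allP x0|i _]; last by rewrite mxE -expr2 sqr_ge0.
apply/eqP/matrixP => i j; rewrite ord1 mxE; have := x0 i (mem_index_enum i).
by rewrite mxE -expr2 sqrf_eq0 => /eqP.
Qed.

Lemma quadf_line M m x v t : M^T = M ->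
  quadf M m (x + t *: v) =
  quadf M m x + t * (2 * dotmx (M *m x) v + dotmx m v)
              + t ^+ 2 * dotmx (M *m v) v.
Proof.
move=> sM; rewrite /quadf mulmxDr -scalemxAr.
rewrite !(dotmxDl, dotmxDr, dotmxZl, dotmxZr) (dotmx_mulC _ v x sM).
by ring.
Qed.

(* Polarization: a symmetric form vanishing on the diagonal is zero. *)
Lemma symmx_neq0_dotmx M : M^T = M -> M != 0 -> exists w, dotmx (M *m w) w != 0.
Proof.
move=> sM /eqP neq0; apply: contrapT => M0; apply: neq0.
apply/matrixP => i j; rewrite mxE.
have {}M0 w : dotmx (M *m w) w = 0.
  by apply/eqP/negPn/negP => Mw; apply: M0; exists w.
have Mij : dotmx (M *m delta_mx j 0) (delta_mx i 0) = M i j.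
  rewrite dotmxC /dotmx trmx_delta mulmxA -rowE -colE.
  by rewrite !mxE.
have := quadf_line M 0 (delta_mx i 0) (delta_mx j 0) 1 sM.
by rewrite /quadf !M0 !dotmx0l (dotmx_mulC _ _ _ sM) Mij; lra.
Qed.

End Dot.

(** * Sign conditions on real polynomials of degree two and four *)

Section Scalar.
Context {R : realType}.
Implicit Types (a b c A B C r t : R).

(** [C] and [A + B + C] are the values at 0 and 1, so a sign change forces an interior root. *)
Lemma quadratic_ivt A B C : C * (A + B + C) < 0 ->
  exists t, [/\ 0 < t, t < 1 & A * t ^+ 2 + B * t + C = 0].
Proof.
wlog C0 : A B C / C <= 0 => [IH|] neg.
  have [/IH|C0] := lerP C 0; first exact.
  have [||t [t0 t1 e]] := IH (- A) (- B) (- C); [lra| |].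
    by rewrite -2!opprD mulrNN.
  by exists t; split=> //; lra.
have Cn : C < 0 by rewrite lt_neqAle C0 andbT; apply: contraTneq neg => ->; lra.
have S0 : 0 < A + B + C by nra.
pose p := A *: 'X^2 + B *: 'X + C%:P.
have pE t : p.[t] = A * t ^+ 2 + B * t + C by rewrite /p !hornerE.
have [||t /andP[t0 t1]] := @poly_ivt _ p 0 1; first lra.
  by rewrite !pE; apply/andP; split; lra.
rewrite /root pE => /eqP e; exists t; split => //.
  by rewrite lt_neqAle t0 andbT; apply: contra_eq_neq e => <-; lra.
by rewrite lt_neqAle t1 andbT; apply: contra_eq_neq e => ->; lra.
Qed.

(* If the root [t] of the first quadratic in ]0, 1[ does not work, then its
   other root [C / (A t)], which lies outside [0, 1], does. *)
Lemma quadratic_pair A B C a b c :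
    C * (A + B + C) < 0 -> c <= 0 -> a + b + c <= 0 ->
  (exists t, A * t ^+ 2 + B * t + C = 0 /\ a * t ^+ 2 + b * t + c <= 0) \/
  (A = 0 /\ a < 0).
Proof.
move=> neg c0 e0; have [t [t0 t1 ht]] := quadratic_ivt _ _ _ neg.
have [kt|kt] := lerP (a * t ^+ 2 + b * t + c) 0; first by left; exists t.
(* Bernstein form on [0, 1]. The end coefficients are nonpositive, so positivity at [t] makes the
   middle one positive; the value is then nonpositive wherever [s * (1 - s) <= 0]. *)
have bary s : a * s ^+ 2 + b * s + c =
  c * (1 - s) ^+ 2 + (a + b + c) * s ^+ 2 + s * (1 - s) * (b + 2 * c) by ring.
have m0 : 0 < b + 2 * c.
  move: kt; rewrite bary.
  have := mulr_le0_ge0 c0 (sqr_ge0 (1 - t)).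
  have := mulr_le0_ge0 e0 (sqr_ge0 t).
  have : 0 < t * (1 - t) by rewrite mulr_gt0 // subr_gt0.
  by move=> tt ? ? ?; rewrite -(pmulr_rgt0 _ tt); lra.
have [A0|A0] := eqVneq A 0; first by right; split; lra.
left; exists (C / (A * t)); set s := C / (A * t).
have CE : C = A * s * t by rewrite /s; field; rewrite A0 gt_eqF.
have BE : B = - (A * (s + t)).
  have t_neq0 : t != 0 by rewrite gt_eqF.
  by apply: (mulIf t_neq0); rewrite CE in ht; lra.
split; first by rewrite BE CE; ring.
have s01 : s * (1 - s) <= 0.
  (* By Vieta, the product of the values at 0 and 1 factors through both roots. *)
  have : (A ^+ 2 * (t * (1 - t))) * (s * (1 - s)) < 0.
    by move: neg; rewrite BE CE; congr (_ < _); ring.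
  rewrite pmulr_rlt0 => [/ltW //|].
  by apply: mulr_gt0; [rewrite exprn_even_gt0 | rewrite mulr_gt0 ?subr_gt0].
rewrite bary.
have := mulr_le0_ge0 c0 (sqr_ge0 (1 - s)).
have := mulr_le0_ge0 e0 (sqr_ge0 s).
have := mulr_le0_ge0 s01 (ltW m0).
by lra.
Qed.

(** For [r >= 1] the lower terms are at most [S * r ^+ 3], which the leading term outweighs for the
    chosen [r]. The bound [1 <= r] later allows division by [r]. *)
Lemma quartic_le0 c0 c1 c2 c3 c4 : c4 < 0 ->
  exists r, 1 <= r /\
    c0 + c1 * r + c2 * r ^+ 2 + c3 * r ^+ 3 + c4 * r ^+ 4 <= 0.
Proof.
move=> c4n; set S := `|c0| + `|c1| + `|c2| + `|c3|.
have S0 : 0 <= S by rewrite !addr_ge0.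
pose r := 1 + S / - c4.
have r1 : 1 <= r by rewrite lerDl divr_ge0 // oppr_ge0 ltW.
exists r; split=> //.
have rE : c4 * r + S = c4 by rewrite /r; field; rewrite lt_eqF.
have r3 : 0 <= r ^+ 3 by rewrite exprn_ge0 //; lra.
have bnd i c : (i <= 3)%N -> c * r ^+ i <= `|c| * r ^+ 3.
  move=> i3; apply: le_trans (_ : `|c| * r ^+ i <= _).
    by rewrite ler_wpM2r ?ler_norm // exprn_ge0 //; lra.
  by rewrite ler_wpM2l // ler_weXn2l.
have := bnd 0%N c0 isT; have := bnd 1%N c1 isT.
have := bnd 2%N c2 isT; have := bnd 3%N c3 isT.
have : c4 * r ^+ 3 <= 0 by rewrite mulr_le0_ge0 // ltW.
have : c4 * r ^+ 4 + S * r ^+ 3 = c4 * r ^+ 3 by rewrite -[in RHS]rE; ring.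
by rewrite /S expr0 expr1; lra.
Qed.

End Scalar.

(** * Joint range of two quadratic functions h and k *)

Section JointRange.
Context {R : realType} {n : nat}.
Implicit Types (H K : 'M[R]_n) (e k x y v : 'cV[R]_n) (s t l : R).

Lemma quadf_unbounded K k v : K^T = K -> dotmx (K *m v) v < 0 ->
  forall x s, exists r, quadf K k (x + r *: v) <= s.
Proof.
move=> sK Kv x s.
(* The step along [v] is a square, so that a quadratic becomes a quartic without odd terms. *)
have [r [_ kr]] := quartic_le0 (quadf K k x - s) 0
  (2 * dotmx (K *m x) v + dotmx k v) 0 _ Kv.
by exists (r ^+ 2); rewrite quadf_line // -exprM; lra.
Qed.

(** A multiple of [v] reaches the level [t]; moving along [u] then stays on it and drives k to
    -oo. *)
Lemma joint_range_full_flat e K k u v : K^T = K ->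
    dotmx (K *m u) u < 0 -> dotmx e u = 0 -> dotmx e v != 0 ->
  forall t s, exists z, dotmx e z = t /\ quadf K k z <= s.
Proof.
move=> sK Ku eu ev t s; set p := (t / dotmx e v) *: v.
have [r kr] := quadf_unbounded K k u sK Ku p s.
by exists (p + r *: u); rewrite dotmxDr !dotmxZr eu; split=> //; field.
Qed.

(* The point at infinity in the direction [v] satisfies [h = 0] and [k < 0]
   strictly; as [H <> 0] it is a limit of points of the level set [h = t]. *)
Lemma joint_range_full_curved H K e k v x0 : H^T = H -> K^T = K -> H != 0 ->
    dotmx (H *m v) v = 0 -> dotmx (K *m v) v < 0 ->
    quadf H e (x0 + v) != quadf H e x0 ->
  forall t s, exists z, quadf H e z = t /\ quadf K k z <= s.
Proof.
move=> sH sK H0 Hv Kv; have := quadf_line H e x0 v 1 sH.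
rewrite scale1r Hv mulr0 mul1r addr0 => -> c0 t s.
set c := 2 * dotmx (H *m x0) v + dotmx e v in c0.
have {}c0 : c != 0 by apply: contra_neq c0 => ->; rewrite addr0.
have [Hv0|Hv0] := eqVneq (H *m v) 0.
  have [w Hw] := symmx_neq0_dotmx H sH H0.
  have ev : dotmx e v = c.
    by rewrite /c (dotmx_mulC _ _ _ sH) Hv0 dotmx0l mulr0 add0r.
  pose q := dotmx (H *m w) w; pose a := dotmx (K *m v) v.
  (* On r w + T v, h is affine in T with slope [c]; T0 + T1 r + T2 r^2 is the solution T of h = t.
     Then k is a quartic in r with leading coefficient [T2 ^+ 2 * a]. *)
  pose T0 := t / c.
  pose T1 := - dotmx e w / c.
  pose T2 := - q / c.
  have T20 : T2 ^+ 2 * a < 0.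
    rewrite pmulr_rlt0 // exprn_even_gt0 //=.
    by rewrite mulf_neq0 ?oppr_eq0 ?invr_eq0.
  pose m0 := dotmx k v; pose m1 := 2 * dotmx (K *m w) v.
  have [r [r1 kr]] := quartic_le0
    (- s + T0 * m0 + T0 ^+ 2 * a)
    (dotmx k w + T0 * m1 + T1 * m0 + 2 * T0 * T1 * a)
    (dotmx (K *m w) w + T1 * m1 + T2 * m0 + (T1 ^+ 2 + 2 * T0 * T2) * a)
    (T2 * m1 + 2 * T1 * T2 * a) _ T20.
  exists (r *: w + (T0 + T1 * r + T2 * r ^+ 2) *: v); split.
    rewrite quadf_line // Hv (dotmx_mulC _ _ _ sH) Hv0 dotmx0l ev.
    rewrite /quadf -scalemxAr !(dotmxZl, dotmxZr) -/q /T0 /T1 /T2.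
    by field.
  rewrite quadf_line // /quadf -!scalemxAr !(dotmxZl, dotmxZr).
  by move: kr; rewrite /m0 /m1 /a; lra.
(* The multiple of [H *m v] is chosen so that h is constant on the line through [x0 + w] in the
   direction [v]. *)
pose w := (- c / (2 * dotmx (H *m v) (H *m v))) *: (H *m v).
have Hvw : dotmx (H *m v) w = - c / 2.
  rewrite dotmxZr; have := dotmx_self_neq0 _ Hv0; move: (dotmx _ _) => D D0.
  by field.
pose p := x0 + w.
have p_v : 2 * dotmx (H *m p) v + dotmx e v = 0.
  rewrite /p mulmxDr dotmxDl [dotmx (H *m w) v]dotmx_mulC // Hvw.
  by rewrite -[RHS](subrr c) /c; field.
have [hp|hp] := eqVneq (quadf H e p) t.
  have [r kr] := quadf_unbounded K k v sK Kv p s.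
  by exists (p + r *: v); rewrite quadf_line // p_v Hv hp; split=> //; ring.
pose h1 := 2 * dotmx (H *m p) w + dotmx e w.
pose h2 := dotmx (H *m w) w.
pose k1 := 2 * dotmx (K *m p) w + dotmx k w.
pose k2 := dotmx (K *m w) w.
pose m0 := 2 * dotmx (K *m p) v + dotmx k v.
pose m1 := 2 * dotmx (K *m w) v.
pose a := dotmx (K *m v) v.
(* At p - w / r the slope of h along [v] is c / r, so T = t2 r + t1 + t0 / r solves h = t there. As
   h(p) differs from [t], [t2] is nonzero. *)
pose t2 := (t - quadf H e p) / c; pose t1 := h1 / c; pose t0 := - h2 / c.
have t20 : t2 ^+ 2 * a < 0.
  rewrite pmulr_rlt0 // exprn_even_gt0 //=.
  by rewrite mulf_neq0 ?invr_eq0 // subr_eq0 eq_sym.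
have [r [r1 kr]] := quartic_le0
  (k2 - t0 * m1 + t0 ^+ 2 * a)
  (- k1 + t0 * m0 - t1 * m1 + 2 * t0 * t1 * a)
  (quadf K k p - s + t1 * m0 - t2 * m1 + (t1 ^+ 2 + 2 * t0 * t2) * a)
  (t2 * m0 + 2 * t1 * t2 * a) _ t20.
have r0 : r != 0 by rewrite gt_eqF //; lra.
pose T := r * t2 + t1 + t0 / r.
exists (p + (- r^-1) *: w + T *: v); split.
  rewrite quadf_line // Hv mulmxDr -scalemxAr dotmxDl dotmxZl.
  rewrite [dotmx (H *m w) v]dotmx_mulC // Hvw quadf_line // -/h1 -/h2.
  have -> : 2 * (dotmx (H *m p) v + - r^-1 * (- c / 2)) + dotmx e v = c / r.
    by rewrite -[RHS]add0r -p_v; field.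
  by rewrite /T /t2 /t1 /t0; field; rewrite r0 c0.
rewrite quadf_line // mulmxDr -scalemxAr dotmxDl dotmxZl quadf_line //.
rewrite -/k1 -/k2 -/a.
have -> : 2 * (dotmx (K *m p) v + - r^-1 * dotmx (K *m w) v) + dotmx k v
          = m0 - m1 / r by rewrite /m0 /m1; field.
(* Multiplying by r^2 turns k - s into the quartic bounded above. *)
rewrite -subr_le0 -(pmulr_rle0 _ (_ : 0 < r ^+ 2)); last first.
  by rewrite exprn_gt0 //; lra.
move: kr; congr (_ <= 0); rewrite /T.
by move: (quadf K k p) => kp; field.
Qed.

(** On the line through [x] and [y], [quadratic_pair] provides the point except when h is affine and
    k strictly concave there; the last hypothesis covers that case. *)
Lemma joint_epigraph_convex H K e k : H^T = H -> K^T = K ->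
    (forall x v, dotmx (H *m v) v = 0 -> dotmx (K *m v) v < 0 ->
      quadf H e (x + v) != quadf H e x ->
      forall t s, exists z, quadf H e z = t /\ quadf K k z <= s) ->
  forall x y l, 0 <= l -> l <= 1 -> exists z,
    quadf H e z = l * quadf H e x + (1 - l) * quadf H e y /\
    quadf K k z <= l * quadf K k x + (1 - l) * quadf K k y.
Proof.
move=> sH sK full x y l l0 l1.
set hx := quadf H e x; set hy := quadf H e y.
set kx := quadf K k x; set ky := quadf K k y.
have [hxy|hxy] := eqVneq hx hy.
  have [kxy|kxy] := lerP kx ky.
    exists x; rewrite -/hx -/kx -hxy; split; first by ring.
    have : 0 <= (1 - l) * (ky - kx) by rewrite mulr_ge0 ?subr_ge0.
    by lra.
  exists y; rewrite -/hy -/ky -hxy; split; first by ring.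
  have : 0 <= l * (kx - ky) by rewrite mulr_ge0 ?subr_ge0 // ltW.
  by lra.
have [->|l0'] := eqVneq l 0; first by exists y; rewrite -/hy -/ky; split; lra.
have [->|l1'] := eqVneq l 1; first by exists x; rewrite -/hx -/kx; split; lra.
have {l0 l0'}l0 : 0 < l by rewrite lt_neqAle eq_sym l0'.
have {l1 l1'}l1 : 0 < 1 - l by rewrite subr_gt0 lt_neqAle l1'.
pose v := y - x.
have yE : y = x + 1 *: v by rewrite scale1r /v addrC subrK.
pose A := dotmx (H *m v) v; pose B := 2 * dotmx (H *m x) v + dotmx e v.
have hyE : hy = hx + B + A.
  by rewrite /hy {1}yE quadf_line // expr1n !mul1r.
pose a := dotmx (K *m v) v; pose b := 2 * dotmx (K *m x) v + dotmx k v.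
have kyE : ky = kx + b + a.
  by rewrite /ky {1}yE quadf_line // expr1n !mul1r.
pose t := l * hx + (1 - l) * hy.
pose s := l * kx + (1 - l) * ky.
(* Subtracting the right multiple of [h - t] makes the two end values of
   [k - s] vanish. *)
pose al := (kx - ky) / (hx - hy).
have alE : al * (hx - hy) = kx - ky by rewrite /al divfK // subr_eq0.
have c0 : kx - s - al * (hx - t) = 0.
  have -> : kx - s - al * (hx - t) =
    (1 - l) * ((kx - ky) - al * (hx - hy)) by rewrite /s /t; ring.
  by rewrite alE subrr mulr0.
have e0 : ky - s - al * (hy - t) = 0.
  have -> : ky - s - al * (hy - t) =
    - l * ((kx - ky) - al * (hx - hy)) by rewrite /s /t; ring.
  by rewrite alE subrr mulr0.
have neg : (hx - t) * (A + B + (hx - t)) < 0.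
  have -> : (hx - t) * (A + B + (hx - t)) = - (l * (1 - l) * (hx - hy) ^+ 2).
    by rewrite /t hyE; ring.
  rewrite oppr_lt0; apply: mulr_gt0; first exact: mulr_gt0.
  by rewrite exprn_even_gt0 //= subr_eq0.
have [||[r [hr kr]]|[A0 a0]] := quadratic_pair A B (hx - t)
  (a - al * A) (b - al * B) (kx - s - al * (hx - t)) neg.
- by rewrite c0.
- by rewrite -e0 hyE kyE; lra.
- exists (x + r *: v); rewrite !quadf_line // -/A -/B -/a -/b -/hx -/kx -/t -/s.
  split; first lra.
  (* At [r] the subtracted multiple of h - t vanishes, leaving the bound on k - s. *)
  have := congr1 (fun z => al * z) hr; rewrite mulr0; lra.
- apply: (full x v) => //; first by rewrite -/a; rewrite A0 in a0; lra.
  by rewrite -[v]scale1r -yE eq_sym.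
Qed.

End JointRange.

(** * Coordinates of the plane adapted to [d] *)

Section Plane.
Context {R : realType}.
Implicit Types (d p q : plane R).

(** With [cross2], these are the coordinates k and h: adding a nonnegative multiple of [d] fixes
    [cross2 d] and can only raise [dot2 d]. *)
Definition dot2 d p : R := d.1 * p.1 + d.2 * p.2.

Definition cross2 d p : R := d.1 * p.2 - d.2 * p.1.

Lemma dot2Z c d p : dot2 d (c *: p) = c * dot2 d p.
Proof.
change (d.1 * (c * p.1) + d.2 * (c * p.2) = c * (d.1 * p.1 + d.2 * p.2) :> R).
by ring.
Qed.

Lemma cross2Z c d p : cross2 d (c *: p) = c * cross2 d p.
Proof.
change (d.1 * (c * p.2) - d.2 * (c * p.1) = c * (d.1 * p.2 - d.2 * p.1) :> R).
by ring.
Qed.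

Lemma dot2D d p q : dot2 d (p + q) = dot2 d p + dot2 d q.
Proof. by rewrite /dot2 /= !mulrDr addrACA. Qed.

Lemma cross2D d p q : cross2 d (p + q) = cross2 d p + cross2 d q.
Proof. by rewrite /cross2 /= !mulrDr opprD addrACA. Qed.

Lemma cross2_self d : cross2 d d = 0.
Proof. by rewrite /cross2 mulrC subrr. Qed.

Lemma dot2_self_gt0 d : d <> 0 -> 0 < dot2 d d.
Proof.
move=> d0; rewrite lt_neqAle addr_ge0 -?expr2 ?sqr_ge0 // andbT eq_sym.
apply/eqP => /eqP; rewrite paddr_eq0 -?expr2 ?sqr_ge0 // !sqrf_eq0.
by case: d d0 => x y /= d0 /andP[/eqP x0 /eqP y0]; apply: d0; rewrite x0 y0.
Qed.

Lemma cross2_eq0P d p : d <> 0 ->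
  reflect (exists c, p = c *: d) (cross2 d p == 0).
Proof.
move=> d0; have dd := dot2_self_gt0 d d0.
apply: (iffP eqP) => [dp|[c ->]]; last by rewrite cross2Z cross2_self mulr0.
(* The coefficient of the orthogonal projection; the error in each coordinate is a multiple of
   [cross2 d p]. *)
exists (dot2 d p / dot2 d d).
have D0 : dot2 d d != 0 by rewrite gt_eqF.
rewrite [LHS]surjective_pairing; congr (_, _); apply: (mulIf D0).
  rewrite [RHS]mulrAC divfK //; apply/eqP; rewrite -subr_eq0; apply/eqP.
  transitivity (- d.2 * cross2 d p); last by rewrite dp mulr0.
  by rewrite /dot2 /cross2; ring.
rewrite [RHS]mulrAC divfK //; apply/eqP; rewrite -subr_eq0; apply/eqP.
transitivity (d.1 * cross2 d p); last by rewrite dp mulr0.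
by rewrite /dot2 /cross2; ring.
Qed.

Lemma free_cross2 d p : d <> 0 -> free [:: d; p] = (cross2 d p != 0).
Proof.
move=> d0; rewrite free_cons seq1_free span_seq1; apply/idP/idP.
  move=> /andP[/vlineP dp p0]; apply/negP => /(cross2_eq0P _ _ d0)[c pE].
  have c0 : c != 0 by apply: contraNneq p0 => c0; rewrite pE c0 scale0r.
  by apply: dp; exists c^-1; rewrite pE scalerA mulVf // scale1r.
move=> dp; apply/andP; split; last first.
  by apply: contraNneq dp => ->; rewrite /cross2 /= !mulr0 subrr.
apply/vlineP => -[c dE]; move/negP: dp; apply.
by rewrite dE; change (c * p.1 * p.2 - c * p.2 * p.1 == 0); apply/eqP; ring.
Qed.

Lemma minkowski_sum_rayP (X : set (plane R)) d q : d <> 0 ->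
  minkowski_sum X (ray d) q <->
  exists2 p, X p & cross2 d p = cross2 d q /\ dot2 d p <= dot2 d q.
Proof.
move=> d0; have dd := dot2_self_gt0 d d0; split.
  move=> [p Xp [_ [t t0 <-] <-]]; exists p => //.
  move: t0; rewrite /= in_itv /= andbT => t0.
  rewrite cross2D cross2Z cross2_self mulr0 addr0; split=> //.
  by rewrite dot2D dot2Z lerDl mulr_ge0 // ltW.
move=> [p Xp [pq1 pq2]]; exists p => //.
have qE : q = p + (q - p) by rewrite addrC subrK.
have /(cross2_eq0P _ _ d0)[t tE] : cross2 d (q - p) == 0.
  by rewrite -(inj_eq (addrI (cross2 d p))) -cross2D -qE pq1 addr0.
exists (t *: d); last by rewrite -tE.
exists t => //=; rewrite in_itv /= andbT -(pmulr_lge0 _ dd) -dot2Z -tE.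
by rewrite -(lerD2l (dot2 d p)) -dot2D -qE addr0.
Qed.

Lemma convex_setP (V : lmodType R) (X : set V) : convex_set X <->
  forall x y l, 0 <= l -> l <= 1 -> X x -> X y -> X (l *: x + (1 - l) *: y).
Proof.
split=> [cX x y l l0 l1 Xx Xy|cX x y l xX yX].
  by apply/set_mem/(cX x y (interval_inference.Itv01 l0 l1)); rewrite inE.
rewrite inE; apply: cX; [| |exact: set_mem..].
  exact: interval_inference.ge0.
exact: interval_inference.le1.
Qed.

End Plane.

(** * Range of a symmetric matrix, and the maps in the adapted coordinates *)

Section Pencil.
Context {R : realType} {n : nat}.
Implicit Types (A B K : 'M[R]_n) (a b k x p : 'cV[R]_n) (d : plane R).

(** The columns of [cokermx K] lie in the kernel of [K], so [k] is orthogonal to them, which puts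
    its transpose in the row space of [K]. *)
Lemma dotmx_kernel_range K k : K^T = K ->
  (forall p, K *m p = 0 -> dotmx k p = 0) -> exists x, K *m x = k.
Proof.
move=> sK kK; have : (k^T <= K)%MS.
  rewrite submxE; apply/eqP/matrixP => i j; rewrite ord1 mxE mxE.
  have := kK (col j (cokermx K)); rewrite colE mulmxA mulmx_coker mul0mx.
  move=> /(_ erefl); rewrite /dotmx -colE mxE => {2}<-.
  by apply: eq_bigr => l _; rewrite !mxE.
case/submxP => D kE; exists D^T.
by apply: trmx_inj; rewrite trmx_mul sK trmxK.
Qed.

Lemma cross2_Fmap A B a b d x : cross2 d (Fmap A B a b x) =
  quadf (d.1 *: B - d.2 *: A) (d.1 *: b - d.2 *: a) x.
Proof.
rewrite /cross2 /quadf /= /quadf mulmxBl -!scalemxAl !dotmxBl !dotmxZl.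
by ring.
Qed.

Lemma dot2_Fmap A B a b d x : dot2 d (Fmap A B a b x) =
  quadf (d.1 *: A + d.2 *: B) (d.1 *: a + d.2 *: b) x.
Proof.
rewrite /dot2 /quadf /= /quadf mulmxDl -!scalemxAl !dotmxDl !dotmxZl.
by ring.
Qed.

Lemma cross2_FL a b d x :
  cross2 d (FL a b x) = dotmx (d.1 *: b - d.2 *: a) x.
Proof. by rewrite dotmxBl !dotmxZl. Qed.

Lemma dot2_FL a b d x : dot2 d (FL a b x) = dotmx (d.1 *: a + d.2 *: b) x.
Proof. by rewrite dotmxDl !dotmxZl. Qed.

Lemma cross2_FH A B d x :
  cross2 d (FH A B x) = dotmx ((d.1 *: B - d.2 *: A) *m x) x.
Proof. by rewrite mulmxBl -!scalemxAl dotmxBl !dotmxZl. Qed.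

Lemma dot2_FH A B d x :
  dot2 d (FH A B x) = dotmx ((d.1 *: A + d.2 *: B) *m x) x.
Proof. by rewrite mulmxDl -!scalemxAl dotmxDl !dotmxZl. Qed.

End Pencil.

(** * Rescaling a vector into the fibre of [FH] over [- d] *)

Section Normalization.
Context {R : realType} {n : nat}.
Implicit Types (A B : 'M[R]_n) (a b x : 'cV[R]_n) (d p : plane R).

Lemma FHZ A B r x : FH A B (r *: x) = r ^+ 2 *: FH A B x.
Proof.
by congr (_, _); rewrite -scalemxAr dotmxZl dotmxZr /GRing.scale /= mulrA expr2.
Qed.

Lemma plane_eq0 d p : d <> 0 -> cross2 d p = 0 -> dot2 d p = 0 -> p = 0.
Proof.
move=> d0 /eqP/(cross2_eq0P _ _ d0)[c ->]; rewrite dot2Z => /eqP.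
rewrite mulf_eq0 [dot2 d d == 0]gt_eqF ?dot2_self_gt0 // orbF => /eqP ->.
exact: scale0r.
Qed.

(** As H = 0, [FH A B x] is a multiple c d, with c < 0 by the sign of its [dot2]; scaling [x] by 1 /
    sqrt(-c) normalizes c to -1. *)
Lemma FH_opp_rescale A B d x : d <> 0 ->
  d.1 *: B - d.2 *: A = 0 -> dotmx ((d.1 *: A + d.2 *: B) *m x) x < 0 ->
  exists2 r, r != 0 & FH A B (r *: x) = - d.
Proof.
move=> d0 H0 Kx; have dd := dot2_self_gt0 d d0.
have /eqP/(cross2_eq0P _ _ d0)[c cE] : cross2 d (FH A B x) = 0.
  by rewrite cross2_FH H0 mul0mx dotmx0l.
have c0 : c < 0 by move: Kx; rewrite -dot2_FH cE dot2Z pmulr_llt0.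
exists (Num.sqrt (- c))^-1.
  by rewrite invr_eq0 gt_eqF // sqrtr_gt0 oppr_gt0.
rewrite FHZ cE scalerA exprVn sqr_sqrtr ?oppr_ge0 ?(ltW c0) //.
by rewrite invrN mulNr mulVf ?lt_eqF // scaleN1r.
Qed.

End Normalization.

(** * Nonconvexity against conditions (b1), (b2) and (b3) *)

Theorem theorem4p13 (R : realType) (n : nat) (n_ge1 : (1 <= n)%N)
    (A B : 'M[R]_n) (symA : A^T = A) (symB : B^T = B)
    (a b : 'cV[R]_n) (d : plane R) (d_neq0 : d <> 0) :
  ~ convex_set (minkowski_sum (range (Fmap A B a b)) (ray d))
  <->
  [/\ FL a b @` (kerset A `&` kerset B) = [set 0],
      d.2 *: A = d.1 *: B
    & FH A B @^-1` [set - d] !=set0 /\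
      forall u : 'cV[R]_n, (FH A B @^-1` [set - d]) u -> free [:: d; FL a b u]].
Proof.
pose H := d.1 *: B - d.2 *: A; pose K := d.1 *: A + d.2 *: B.
pose e := d.1 *: b - d.2 *: a; pose k := d.1 *: a + d.2 *: b.
have sH : H^T = H by rewrite /H raddfB /= !linearZ /= symA symB.
have sK : K^T = K by rewrite /K raddfD /= !linearZ /= symA symB.
have dd := dot2_self_gt0 d d_neq0.
have quad0 x : quadf 0 e x = dotmx e x by rewrite /quadf mul0mx dotmx0l add0r.
split=> [ncv|[b1 b2 [[u Fu] b3]] cv].
  (* Nonconvexity provides an exceptional direction [v] and a pair [t], [s] showing that E is not
     the whole plane. *)
  have [x [v [Hv Kv hxv [t [s tss]]]]] : exists x v,
      [/\ dotmx (H *m v) v = 0, dotmx (K *m v) v < 0,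
          quadf H e (x + v) != quadf H e x &
          exists t s, ~ exists z, quadf H e z = t /\ quadf K k z <= s].
    apply: contrapT => full; apply: ncv; apply/convex_setP => p q l l0 l1.
    move=> /minkowski_sum_rayP -/(_ d_neq0)[_ [x _ <-] [px1 px2]].
    move=> /minkowski_sum_rayP -/(_ d_neq0)[_ [y _ <-] [qy1 qy2]].
    have [|z [z1 z2]] := joint_epigraph_convex H K e k sH sK _ x y l l0 l1.
      move=> x' v Hv Kv hv t s; apply: contrapT => tss; apply: full.
      by exists x', v; split=> //; exists t, s.
    apply/minkowski_sum_rayP => //; exists (Fmap A B a b z); first by exists z.
    rewrite cross2D dot2D !cross2Z !dot2Z -px1 -qy1 !cross2_Fmap.
    split; first exact: z1.
    apply: le_trans (_ : l * quadf K k x + (1 - l) * quadf K k y <= _).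
      by rewrite dot2_Fmap.
    by rewrite -!dot2_Fmap lerD // ler_wpM2l // subr_ge0.
  have H0 : H = 0.
    apply/eqP/negPn/negP => H0; apply: tss.
    exact: (joint_range_full_curved H K e k v x sH sK H0).
  rewrite H0 !quad0 dotmxDr -subr_eq0 addrC addKr in hxv.
  have flat u : dotmx (K *m u) u < 0 -> dotmx e u != 0.
    move=> Ku; apply/negP => /eqP eu; apply: tss.
    have [z] := joint_range_full_flat e K k u v sK Ku eu hxv t s.
    by exists z; rewrite H0 quad0.
  split; last split.
  - apply/seteqP; split=> [_ [p [Ap Bp] <-]|_ ->]; last first.
      exists 0; first by split; rewrite /kerset /= mulmx0.
      by rewrite /FL !(dotmxC _ 0) !dotmx0l.
    have Kp : K *m p = 0.
      by rewrite mulmxDl -!scalemxAl Ap Bp !scaler0 addr0.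
    have ep : dotmx e p = 0.
      apply/eqP/negPn/negP => ep.
      (* This vector is annihilated by [e] and has the same [K]-value as [v], because
         [K *m p = 0]. *)
      have := flat (v + (- (dotmx e v / dotmx e p)) *: p).
      rewrite mulmxDr -scalemxAr Kp scaler0 addr0 !dotmxDr !dotmxZr.
      rewrite (dotmx_mulC K v p sK) Kp dotmx0l mulr0 addr0 mulNr divfK //.
      by rewrite subrr eqxx => /(_ Kv).
    apply: (plane_eq0 d) => //; first by rewrite cross2_FL.
    rewrite dot2_FL; apply/eqP/negPn/negP => kp; apply: tss.
    (* [z] lies on the level [t]; along [p], h is constant and k affine with nonzero slope, so k
       takes the value [s]. *)
    pose z := (t / dotmx e v) *: v.
    exists (z + ((s - quadf K k z) / dotmx k p) *: p); split.
      by rewrite H0 quad0 dotmxDr !dotmxZr ep mulr0 addr0 divfK.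
    rewrite quadf_line // Kp dotmx0l (dotmx_mulC K z p sK) Kp dotmx0l.
    by rewrite !mulr0 add0r addr0 divfK // addrC subrK.
  - by apply/esym/eqP; rewrite -subr_eq0 -/H H0.
  - by have [r _ rE] := FH_opp_rescale A B d v d_neq0 H0 Kv; exists (r *: v).
  - move=> u Fu; rewrite free_cross2 // cross2_FL; apply: flat.
    by rewrite -dot2_FH Fu -scaleN1r dot2Z mulN1r oppr_lt0.
have H0 : H = 0 by rewrite /H b2 subrr.
(* A negative value would rescale to a point of the fibre over [- d] at which [FL] is parallel to
   [d]. *)
have K_psd y : dotmx e y = 0 -> 0 <= dotmx (K *m y) y.
  move=> ey; rewrite leNgt; apply/negP => Ky.
  have [r _ rE] := FH_opp_rescale A B d y d_neq0 H0 Ky.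
  have := b3 _ rE; rewrite free_cross2 // cross2_FL dotmxZr.
  by rewrite -/e ey mulr0 eqxx.
have Ku : dotmx (K *m u) u < 0.
  by rewrite -dot2_FH Fu -scaleN1r dot2Z mulN1r oppr_lt0.
(* By (b2), [A] and [B] are multiples of [K], so (b1) makes [k] vanish on the kernel of [K]. *)
have [x1 x1E] : exists x, K *m x = k.
  apply: dotmx_kernel_range => // p Kp.
  have AB i j : d.2 * A i j = d.1 * B i j.
    by have /matrixP/(_ i j) := b2; rewrite !mxE.
  have KA : d.1 *: K = dot2 d d *: A.
    apply/matrixP => i j; rewrite !mxE mulrDr [d.1 * (d.2 * _)]mulrCA -AB.
    by rewrite /dot2; ring.
  have KB : d.2 *: K = dot2 d d *: B.
    apply/matrixP => i j; rewrite !mxE mulrDr [d.2 * (d.1 * _)]mulrCA AB.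
    by rewrite /dot2; ring.
  have ker c M : c *: K = dot2 d d *: M -> M *m p = 0.
    move=> KM; apply: (scalerI (lt0r_neq0 dd)).
    by rewrite scalemxAl -KM -scalemxAl Kp !scaler0.
  have : [set 0] (FL a b p).
    by rewrite -b1; exists p => //; split; apply: ker; [exact: KA|exact: KB].
  by rewrite -dot2_FL => ->; rewrite /dot2 /= !mulr0 addr0.
(* The critical point of k: 2 K x0 + k = 0. *)
pose x0 := (- 2^-1) *: x1.
have crit y : 2 * dotmx (K *m x0) y + dotmx k y = 0.
  by rewrite -scalemxAr x1E dotmxZl; field.
have k_line r y : quadf K k (x0 + r *: y) =
    quadf K k x0 + r ^+ 2 * dotmx (K *m y) y.
  by rewrite quadf_line // crit mulr0 addr0.
have mem x : minkowski_sum (range (Fmap A B a b)) (ray d) (Fmap A B a b x).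
  by apply/minkowski_sum_rayP => //; exists (Fmap A B a b x) => //; exists x.
have mem1 := mem (x0 + 1 *: u); have mem2 := mem (x0 + (-1) *: u).
have /convex_setP/(_ _ _ 2^-1 _ _ mem1 mem2) := cv.
rewrite invr_ge0 ler0n invf_le1 // ler1n.
move=> /(_ isT isT) /(minkowski_sum_rayP _ _ _ d_neq0)[_ [z _ <-]].
rewrite cross2D dot2D !cross2Z !dot2Z !cross2_Fmap !dot2_Fmap.
rewrite -/H -/K -/e -/k H0 !quad0 !k_line !(dotmxDr _ _ e) !(dotmxZr _ u e).
move=> -[ez]; have zE : z = x0 + 1 *: (z - x0) by rewrite scale1r addrC subrK.
(* The midpoint has the h-value of [x0], so [z - x0] is in the kernel of [e] and k(z) >= k(x0),
   while the midpoint's k-value is below k(x0). *)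
have /K_psd y0 : dotmx e (z - x0) = 0.
  by rewrite dotmxC dotmxBl !(dotmxC _ e) ez; field.
by rewrite zE k_line; lra.
Qed.
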